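(* Let $G$ be an $N$-free ordered group with identity $e$ and let $K\le G$ be a subgroup, with the induced order. Put $$\mathcal A_K:=\{S_G(e,k):k\in K\setminus\{e\}\}\subseteq\mathcal V(G).$$ Let $\mathcal B_K$ be the chain of maximal nonempty convex subsets of the chain $\mathcal A_K$ on which the type is constant, and for $H\in\mathcal A_K$ let $[H]$ denote the member of $\mathcal B_K$ containing $H$. For $B\in\mathcal B_K$, define $$M_B:=\{e\}\cup\{k\in K\setminus\{e\}:[S_G(e,k)]\le B\}.$$ Then $$\mathcal V(K)=\{M_B:B\in\mathcal B_K\},$$ and $M_B$ has (as a canonical level of the ordered group $K$) the common type of the ambient levels in $B$. In particular, when $K$ meets only finitely many ambient canonical levels (i.e. $\mathcal A_K$ is finite), the canonical chain of $K$ is obtained from that of $G$ by deleting the ambient levels not met by $K$ (those not in $\mathcal A_K$) and coalescing consecutive remaining levels of the same type.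
   Context: An ordered group is a group $G$ (identity $e$) equipped with a partial order $\le$ such that $x\le y$ implies $axb\le ayb$ for all $a,b,x,y\in G$. A poset is $N$-free if it has no four distinct elements $a,b,c,d$ whose only strict comparabilities among themselves are $a<b$, $c<b$, $c<d$. A module of a poset $X$ is a subset $M$ such that for every $x\in X\setminus M$ and $m,m'\in M$: $x\le m\iff x\le m'$ and $m\le x\iff m'\le x$. A nonempty module $M$ is strong if every module is disjoint from $M$, contained in $M$, or contains $M$. For an ordered group $G$, $S_G(x,y)$ is the least strong module of the poset $G$ containing $x$ and $y$; the canonical chain is $\mathcal V(G):=\{S_G(e,g):g\ne e\}$ (its members are the canonical levels), and $H^-:=\{e\}\cup\bigcup\{L\in\mathcal V(G):L\subsetneq H\}$ for $H\in\mathcal V(G)$. It is known that $\mathcal V(G)$ is a chain, under inclusion, of convex subgroups, and that $H^-$ is a proper convex normal subgroup of $H$; $H/H^-$ carries the quotient order ($\alpha\le\beta$ iff $a\le b$ for some $a\in\alpha,b\in\beta$). If $G$ is $N$-free, each $H/H^-$ is either totally ordered, in which case $H$ has type $\mathbf C$, or equality-ordered (order is equality), in which case $H$ has type $\mathbf A$. The same notions apply to $K$ with its induced order, which is again an $N$-free ordered group. A subset $B$ of a chain $\mathcal A$ is convex if $H\le L\le H'$ with $H,H'\in B$, $L\in\mathcal A$ implies $L\in B$. The members of $\mathcal B_K$ partition $\mathcal A_K$ and are ordered as blocks: $B<B'$ iff every member of $B$ is strictly below every member of $B'$. *)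

(* Defs.v *)
From HB Require Import structures.
From mathcomp Require Import all_boot all_order.
From mathcomp Require Import all_classical.

Set Implicit Arguments.
Unset Strict Implicit.
Unset Printing Implicit Defensive.

Local Open Scope classical_set_scope.
Local Open Scope order_scope.
Local Open Scope group_scope.

HB.mixin Record isOrderedGroup d G of Group G & Order.POrder d G := {
  mulg_le2 : forall a b x y : G, x <= y -> a * x * b <= a * y * b
}.

#[short(type="orderedGroupType")]
HB.structure Definition OrderedGroup d :=
  {G of Group G & Order.POrder d G & isOrderedGroup d G}.

Definition induced d (G : orderedGroupType d) (K : groupClosed G) : Type :=
  {x : G | x \in K}.

Section Induced.
Variables (d : Order.disp_t) (G : orderedGroupType d) (K : groupClosed G).

Let group_closed_induced : group_closed K.
Proof. by split=> [|x y xK yK]; [exact: gpred1 | rewrite gpredM ?gpredV]. Qed.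

HB.instance Definition _ :=
  [isSub of induced K for (@sval G (fun x => x \in K))].
HB.instance Definition _ := [Choice of induced K by <:].
HB.instance Definition _ :=
  @SubChoice_isSubGroup.Build G (mem K) (induced K) group_closed_induced.
HB.instance Definition _ := [SubChoice_isSubPOrder of induced K by <: with d].

Lemma induced_mulg_le2 (a b x y : induced K) :
  x <= y -> a * x * b <= a * y * b.
Proof. exact: mulg_le2. Qed.

HB.instance Definition _ := isOrderedGroup.Build d (induced K) induced_mulg_le2.
End Induced.

Section Posets.
Variables (d : Order.disp_t) (X : porderType d).

Definition N_free : Prop :=
  ~ exists a b c e : X, let s := [:: a; b; c; e] in
    uniq s /\ {in s &, forall x y,
      (x < y) = ((x, y) \in [:: (a, b); (c, b); (c, e)])}.

Definition is_module (M : set X) : Prop :=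
  forall x m m', ~ M x -> M m -> M m' ->
    ((x <= m) <-> (x <= m')) /\ ((m <= x) <-> (m' <= x)).

Definition strong_module (M : set X) : Prop :=
  [/\ M !=set0, is_module M &
      forall N, is_module N -> [\/ N `&` M = set0, N `<=` M | M `<=` N]].

(* smallest is the intersection of the strong modules containing x and y; an
   intersection of strong modules with a common point is again strong, so this
   is the least one. *)
Definition strong_hull (x y : X) : set X :=
  smallest strong_module [set x; y].
End Posets.

Variant level_type := TypeC | TypeA.

Section CanonicalLevels.
Variables (d : Order.disp_t) (G : orderedGroupType d).

Definition canonical_chain : set (set G) :=
  [set strong_hull 1 g | g in [set g : G | g != 1]].

Definition lower (H : set G) : set G :=
  [set 1] `|` \bigcup_(L in [set L | canonical_chain L /\ L `<` H]) L.

(* The quotient H / H^-, as a set of cosets; lower H is H^-. *)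
Definition level_quotient (H : set G) : set (set G) :=
  [set [set x * n | n in lower H] | x in H].

Definition coset_le (A B : set G) : Prop :=
  exists a b, [/\ A a, B b & a <= b].

Definition has_type (H : set G) (t : level_type) : Prop :=
  match t with
  | TypeC => forall A B, level_quotient H A -> level_quotient H B ->
               coset_le A B \/ coset_le B A
  | TypeA => forall A B, level_quotient H A -> level_quotient H B ->
               (coset_le A B <-> A = B)
  end.

Definition common_type (B : set (set G)) (t : level_type) : Prop :=
  forall H, B H -> has_type H t.

Definition same_type (H L : set G) : Prop :=
  exists t, has_type H t /\ has_type L t.
End CanonicalLevels.
Arguments canonical_chain {d} G _.

Section Chains.
Variable (T : Type).

Definition convex_in (A B : set (set T)) : Prop :=
  B `<=` A /\
  forall H L H', B H -> B H' -> A L -> H `<=` L -> L `<=` H' -> B L.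

Definition block_lt (B B' : set (set T)) : Prop :=
  forall H H', B H -> B' H' -> H `<` H'.

Definition block_le (B B' : set (set T)) : Prop := B = B' \/ block_lt B B'.

Definition enumerates (s : seq (set T)) (A : set (set T)) : Prop :=
  [set` s] = A /\
  forall i j, (i < j < size s)%N -> nth set0 s i `<` nth set0 s j.
End Chains.

(* Cuts s into its maximal runs of consecutive r-related entries. *)
Fixpoint runs (T : Type) (r : rel T) (s : seq T) : seq (seq T) :=
  if s isn't x :: s' then [::] else
  match runs r s' with
  | (y :: b) :: bs => if r x y then (x :: y :: b) :: bs
                      else [:: x] :: (y :: b) :: bs
  | bs => [:: x] :: bs
  end.

Section Subgroups.
Variables (d : Order.disp_t) (G : orderedGroupType d) (K : groupClosed G).

Definition met_levels : set (set G) :=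
  [set strong_hull 1 k | k in [set k : G | k \in K /\ k != 1]].

Definition typed_convex (B : set (set G)) : Prop :=
  [/\ B !=set0, convex_in met_levels B & exists t, common_type B t].

Definition blocks : set (set (set G)) :=
  [set B | typed_convex B /\ forall B', typed_convex B' -> B `<=` B' -> B' = B].

(* The blocks partition the met levels; set0 is only a default value. *)
Definition block_of (H : set G) : set (set G) :=
  xget set0 [set B | blocks B /\ B H].

Definition block_level (B : set (set G)) : set (induced K) :=
  [set 1] `|` [set k | k != 1 /\ block_le (block_of (strong_hull 1 (\val k))) B].

Definition coalesce (b : seq (set G)) : set (induced K) :=
  \val @^-1` \bigcup_(L in [set` b]) L.
End Subgroups.
Arguments met_levels {d G} K _.
Arguments blocks {d G} K _.
Arguments block_level {d G} K B _.
Arguments coalesce {d G} K b _.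

(* Main.v *)
(** In an N-free poset the strict comparability relation and its complement are
    both free of induced four-vertex paths. Let r be the one of the two that
    relates x to y, and s the other. The least strong module containing x and y
    is then
      { h | every w with w s x and w s y satisfies w s h },
    so inside an ordered group the level of g is given by a first-order formula
    whose shape depends only on whether g is comparable to 1, which is also the
    type of the level. Applied in K instead of G, the formula quantifies over
    fewer w: an element k' lies in the level of k in K unless some w in K of the
    other type has an ambient level between those of k and k'. That is the order
    on the blocks. *)

Require Import Defs.
From mathcomp Require Import all_boot all_order.
From mathcomp Require Import all_classical.

Set Implicit Arguments.
Unset Strict Implicit.
Unset Printing Implicit Defensive.

Import Order.Theory.

Local Open Scope classical_set_scope.

Lemma subset_proper_trans (T : Type) (A B C : set T) :
  A `<=` B -> B `<` C -> A `<` C.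
Proof.
move=> AB [BC nCB]; split; first exact: subset_trans BC.
by move=> CA; apply: nCB; exact: subset_trans CA AB.
Qed.

(** * Graphs without induced four-vertex paths *)

Section Cographs.
Variable T : Type.
Implicit Types (r : T -> T -> Prop) (M N : set T).

Definition anti r x y := x <> y /\ ~ r x y.

Record cograph r : Prop := Cograph {
  cograph_irr : forall x, ~ r x x;
  cograph_sym : forall x y, r x y -> r y x;
  cograph_P4 : forall a b c e, r a b -> r b c -> r c e ->
    anti r a c -> anti r b e -> anti r a e -> False }.

Definition graph_module r M :=
  forall z m m', ~ M z -> M m -> M m' -> r z m -> r z m'.

Definition span r x y : set T :=
  [set h | forall w, r w x -> r w y -> r w h].

Lemma eq_or_adj_or_anti r x y : [\/ x = y, r x y | anti r x y].
Proof.
have [->|nxy] := pselect (x = y); first exact: Or31.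
by have [rxy|nrxy] := pselect (r x y); [exact: Or32 | exact: Or33].
Qed.

Lemma antiK r : cograph r -> anti (anti r) = r.
Proof.
move=> cr; apply/funext => x; apply/funext => y; apply/propext; split.
  by move=> [nxy nn]; apply: contrapT => nr; exact: nn.
move=> rxy; split; last by case.
by move=> exy; move: rxy; rewrite exy; exact: cograph_irr.
Qed.

Lemma anti_sym r x y : cograph r -> anti r x y -> anti r y x.
Proof.
move=> cr [nxy nr]; split; first by move=> /esym.
by move=> /(cograph_sym cr).
Qed.

(* The complement of a four-vertex path is again a four-vertex path. *)
Lemma anti_cograph r : cograph r -> cograph (anti r).
Proof.
move=> cr; split; first by move=> x [].
  by move=> x y; exact: anti_sym.
move=> a b c e ab bc ce; rewrite antiK// => ac be ae.
have sy := cograph_sym cr; have asy x y := @anti_sym r x y cr.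
exact: (cograph_P4 cr (sy _ _ ac) ae (sy _ _ be) ce ab (asy _ _ bc)).
Qed.

Lemma graph_module_anti r M :
  cograph r -> graph_module r M -> graph_module (anti r) M.
Proof.
move=> cr mM z m m' nz Mm Mm' [_ nr]; split.
  by move=> zm'; apply: nz; rewrite zm'.
by move=> /(mM _ _ _ nz Mm' Mm).
Qed.

Lemma span_l r x y : span r x y x. Proof. by []. Qed.
Lemma span_r r x y : span r x y y. Proof. by []. Qed.

Lemma spanC r x y : span r x y = span r y x.
Proof. by apply/seteqP; split=> z Dz w wx wy; exact: Dz. Qed.

(** As [z] is outside, some [w] is anti-related to [x] and [y] but not to [z]. If [w] is joined to
    [z], forbidding induced paths that end in [z], [w] makes [z] treat [x] and [y] alike, and
    adjacency to both extends to all of [D]. The witness [w] is kept: it later fixes the side of [z]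
    on which [D] lies. *)
Lemma span_out r x y z (D := span (anti r) x y) :
  cograph r -> r x y -> ~ D z ->
  (forall h, D h -> anti r z h) \/
  (forall h, D h -> r z h) /\ exists w, r w z /\ forall h, D h -> anti r w h.
Proof.
move=> cr rxy nDz.
have sy := cograph_sym cr; have asy x' y' := @anti_sym r x' y' cr.
have [w [wx wy nwz]] : exists w, [/\ anti r w x, anti r w y & ~ anti r w z].
  apply: contrapT => nw; apply: nDz => w wx wy; apply: contrapT => nwz.
  by apply: nw; exists w.
case: (eq_or_adj_or_anti r w z) => // [wz|rwz].
  by left => h Dh; rewrite -wz; exact: Dh.
have zxy : (anti r z x /\ anti r z y) \/ (r z x /\ r z y).
  case: (eq_or_adj_or_anti r z x) => zx.
  - by case: wx => _ []; rewrite -zx.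
  - case: (eq_or_adj_or_anti r z y) => zy.
    + by case: wy => _ []; rewrite -zy.
    + by right.
    + by case: (cograph_P4 cr (sy _ _ rxy) (sy _ _ zx) (sy _ _ rwz));
        exact: asy.
  - case: (eq_or_adj_or_anti r z y) => zy.
    + by case: wy => _ []; rewrite -zy.
    + by case: (cograph_P4 cr rxy (sy _ _ zy) (sy _ _ rwz)); exact: asy.
    + by left.
case: zxy => -[zx zy]; first by left => h Dh; exact: Dh.
right; split; last by exists w; split => // h Dh; exact: Dh.
move=> h Dh; have wh := Dh _ wx wy.
have P4 u : r u z -> anti r w u -> r h u -> anti r z h -> False.
  move=> uz wu hu zh.
  by apply: (cograph_P4 cr hu uz (sy _ _ rwz)); exact: asy.
case: (eq_or_adj_or_anti r z h) => // zh.
  by case: wh => _ []; rewrite -zh.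
(* [h] is joined to [x] or [y], since otherwise [Dh] would make it anti-related to itself. With that
   neighbour as [u], the path is [h], [u], [z], [w]. *)
exfalso; case: (eq_or_adj_or_anti r h x) => hx.
- by case: zh => _ []; rewrite hx.
- by apply: (P4 x) => //; exact: sy.
- case: (eq_or_adj_or_anti r h y) => hy.
  + by case: zh => _ []; rewrite hy.
  + by apply: (P4 y) => //; exact: sy.
  + by case: (Dh h hx hy).
Qed.

(** Take [z] in [N] outside [D]. If [z] is anti-related to [D], membership in [N] spreads along the
    edges of [D], which is connected through [x] and [y]. If [z] is joined to [D], first [w] is
    forced into [N], and then all of [D]. *)
Lemma span_strong r x y N (D := span (anti r) x y) :
  cograph r -> r x y -> graph_module r N -> N `&` D !=set0 ->
  N `<=` D \/ D `<=` N.
Proof.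
move=> cr rxy mN [n [Nn Dn]].
have [|/existsNP[z /not_implyP[Nz nDz]]] := pselect (N `<=` D); first by left.
right; have sy := cograph_sym cr.
case: (span_out cr rxy nDz) => [az|[rz [w [rwz aw]]]].
  have conn u v : D u -> D v -> r u v -> N u -> N v.
    move=> Du Dv ruv Nu; apply: contrapT => nNv.
    have rvz := mN _ _ _ nNv Nu Nz (sy _ _ ruv).
    by case: (az _ Dv) => _; apply; exact: sy.
  have nbr h : D h -> [\/ h = x, h = y, r h x | r h y].
    move=> Dh; case: (eq_or_adj_or_anti r h x) => hx.
    - exact: Or41.
    - exact: Or43.
    case: (eq_or_adj_or_anti r h y) => hy.
    - exact: Or42.
    - exact: Or44.
    by case: (Dh h hx hy).
  have Nx : N x.
    case: (nbr n Dn) => nE.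
    - by rewrite -nE.
    - by apply: (conn y x) => //; [exact: sy | rewrite -nE].
    - exact: (conn n x).
    - by apply: (conn y x) => //; [exact: sy | exact: (conn n y)].
  have Ny : N y by exact: (conn x y).
  move=> d Dd; case: (nbr d Dd) => [->|->|dx|dy] //.
    by apply: (conn x d) => //; exact: sy.
  by apply: (conn y d) => //; exact: sy.
have Nw : N w.
  apply: contrapT => nNw; case: (aw _ Dn) => _; apply.
  exact: (mN _ _ _ nNw Nz Nn rwz).
move=> d Dd; apply: contrapT => nNd; case: (aw _ Dd) => _; apply.
by apply: (sy); apply: (mN _ _ _ nNd Nz Nw); apply: (sy); exact: rz.
Qed.

End Cographs.

(** * Order modules of strict orders *)

Section StrictOrders.
Variable T : Type.
Implicit Types (R : T -> T -> Prop) (M N : set T).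

Definition cmp R x y := R x y \/ R y x.

Definition strict_order R :=
  (forall x, ~ R x x) /\ (forall x y z, R x y -> R y z -> R x z).

Definition order_module R M := forall z m m', ~ M z -> M m -> M m' ->
  (R z m -> R z m') /\ (R m z -> R m' z).

Lemma cmp_flip R : cmp (fun x y => R y x) = cmp R.
Proof.
apply/funext => x; apply/funext => y; apply/propext.
by split=> -[]; [right|left|right|left].
Qed.

Lemma order_module_graph R M : order_module R M -> graph_module (cmp R) M.
Proof.
move=> mM z m m' nz Mm Mm'; have [h1 h2] := mM _ _ _ nz Mm Mm'.
by case=> [/h1|/h2]; [left|right].
Qed.

(** If [z] were below one point of [D] and above another, transitivity would make [w], which is
    comparable to [z], comparable to one of the two. *)
Lemma span_anti_order_module R x y : strict_order R -> cograph (cmp R) ->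
  cmp R x y -> order_module R (span (anti (cmp R)) x y).
Proof.
move=> [irr tr] cr rxy z m m' nz Dm Dm'.
case: (span_out cr rxy nz) => [az|[rz [w [rwz aw]]]].
  by case: (az _ Dm) => _ nr; split => h; case: nr; [left|right].
have [[_ awm] [_ awm']] := (aw _ Dm, aw _ Dm').
split => h; case: (rz _ Dm') => // h'; exfalso; case: rwz => hw.
- by apply: awm; left; exact: tr h.
- by apply: awm'; right; exact: tr hw.
- by apply: awm'; left; exact: tr h'.
- by apply: awm; right; exact: tr hw.
Qed.

Lemma span_cmp_order_module R x y : strict_order R -> cograph (cmp R) ->
  anti (cmp R) x y -> order_module R (span (cmp R) x y).
Proof.
move=> [irr tr] cr axy.
have car := anti_cograph cr.
(* [span_out] is applied to the incomparability graph, whose complement is [cmp R] again. *)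
rewrite -{1}(antiK cr) => z m m' nz Dm Dm'.
case: (span_out car axy nz) => [|[az _]]; last first.
  by case: (az _ Dm) => _ nr; split => h; case: nr; [left|right].
rewrite (antiK cr) in Dm Dm' * => rz.
(* A point of the span on the same side of both [x] and [y] would be comparable to itself. *)
have noside h : span (cmp R) x y h ->
    ~ (R h x /\ R h y) /\ ~ (R x h /\ R y h).
  move=> Dh; split=> -[hx hy].
    by case: (Dh h (or_introl hx) (or_introl hy)); exact: irr.
  by case: (Dh h (or_intror hx) (or_intror hy)); exact: irr.
case: axy => _ nxy.
have side : (R z x /\ R z y) \/ (R x z /\ R y z).
  case: (rz _ (@span_l _ (cmp R) x y)) => zx;
  case: (rz _ (@span_r _ (cmp R) x y)) => zy.
  - by left.
  - by case: nxy; right; exact: tr zy zx.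
  - by case: nxy; left; exact: tr zx zy.
  - by right.
have [[dm um] [dm' um']] := (noside _ Dm, noside _ Dm').
split => h; case: (rz _ Dm') => // h'; exfalso; case: side => -[zx zy].
- by apply: dm'; split; apply: tr h' _.
- by apply: um; split; apply: tr h.
- by apply: dm; split; apply: (tr _ _ _ h).
- by apply: um'; split; apply: tr h'.
Qed.

(** * Submodules of a span and overlap-free modules *)

Section Parts.
Variables (R : T -> T -> Prop) (x y : T).
Hypotheses (oR : strict_order R) (cr : cograph (cmp R)).

(* In a span, which is a lexicographic sum over a chain, this is the union of
   the summands above that of x. *)
Lemma upper_part_module (D := span (anti (cmp R)) x y) : R x y ->
  order_module R
    [set z | [/\ D z, R x z & forall t, D t -> anti (cmp R) t x -> cmp R t z]].
Proof.
move=> Rxy u z z' nMu [Dz xz hz] [Dz' xz' hz'].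
case: oR => irr tr.
have mD : order_module R D by apply: span_anti_order_module => //; left.
have [Du|nDu] := pselect (D u); last exact: mD.
suff below v : D v -> R x v ->
    (forall t, D t -> anti (cmp R) t x -> cmp R t v) -> R u v.
  split => [_|zu]; first exact: below.
  by case: (irr z); apply: tr zu _; exact: below.
move=> Dv xv hv.
case: (eq_or_adj_or_anti (cmp R) u x) => [->//|[ux|xu]|ux].
- exact: tr ux xv.
(* [u] is above [x] but not in the upper part; [t] witnesses this. It excludes [u] above [v] by
   transitivity, and [u] incomparable to [v] by the path [u], [x], [v], [t]. *)
- have [t [Dt tx ntu]] :
      exists t, [/\ D t, anti (cmp R) t x & ~ cmp R t u].
    apply: contrapT => nt; apply: nMu; split => // t Dt tx.
    by apply: contrapT => ntu; apply: nt; exists t.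
  have atu : anti (cmp R) t u.
    by split => // tu; case: tx => _; apply; rewrite tu; right.
  have tv : R t v.
    case: (hv _ Dt tx) => // vt.
    by case: tx => _ []; right; exact: tr vt.
  case: (eq_or_adj_or_anti (cmp R) u v) => [uv|[//|vu]|uv].
  + by case: ntu; left; rewrite uv.
  + by case: ntu; left; exact: tr vu.
  + exfalso; apply: (@cograph_P4 _ _ cr u x v t) => //.
    * by right.
    * by left.
    * by right.
    * exact: anti_sym.
    * exact: anti_sym.
- case: (hv _ Du ux) => // vu; case: ux => _ []; right; exact: tr vu.
Qed.

(* In a span that is a disjoint sum, this is the union of the summands other
   than that of x. *)
Lemma other_part_module (D := span (cmp R) x y) : anti (cmp R) x y ->
  order_module R [set z | [/\ D z, anti (cmp R) x z &
    forall t, D t -> cmp R t x -> anti (cmp R) t z]].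
Proof.
move=> axy u z z' nMu [Dz xz hz] [Dz' xz' hz'].
have mD : order_module R D by exact: span_cmp_order_module.
have [Du|nDu] := pselect (D u); last exact: mD.
suff : anti (cmp R) u z.
  by move=> [_ n]; split => h; case: n; [left|right].
case: (eq_or_adj_or_anti (cmp R) u x) => [->//|ux|ux]; first exact: hz.
have [t [Dt tx nautu]] :
    exists t, [/\ D t, cmp R t x & ~ anti (cmp R) t u].
  apply: contrapT => nt; apply: nMu; split => //; first exact: anti_sym.
  by move=> t Dt tx; apply: contrapT => ntu; apply: nt; exists t.
have tz := hz _ Dt tx.
have sy := cograph_sym cr.
case: (eq_or_adj_or_anti (cmp R) t u) => // [tu|tu].
  by case: ux => _ []; rewrite -tu.
case: (eq_or_adj_or_anti (cmp R) u z) => // [uz|uz].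
  by case: tz => _ []; rewrite -uz.
exfalso; apply: (@cograph_P4 _ _ cr x t u z) => //; first exact: sy.
exact: anti_sym.
Qed.

Definition overlap_free N :=
  forall M, order_module R M -> M `&` N !=set0 -> M `<=` N \/ N `<=` M.

(** The upper part contains [y] and, if [h] is not in [N], also [h]. So it meets [N] without being
    inside it, and it does not contain [N] because it omits [x]: the two overlap. *)
Lemma span_anti_sub_upper N h : R x y -> order_module R N -> overlap_free N ->
  N x -> N y -> span (anti (cmp R)) x y h -> R x h -> N h.
Proof.
move=> Rxy mN oN Nx Ny Dh xh; apply: contrapT => nNh.
have gN := order_module_graph mN; have sy := cograph_sym cr.
case: (oN _ (upper_part_module Rxy)).
- exists y; split => //; split => // t Dt tx.
  case: (eq_or_adj_or_anti (cmp R) t y) => // ty.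
    by case: tx => _ []; rewrite ty; right.
  by case: (Dt _ tx ty).
- move=> /(_ h); case/(_ _)/nNh => //; split => // t Dt tx.
  case: (eq_or_adj_or_anti (cmp R) t y) => [ty|ty|ty].
  + by subst t; apply: (sy); apply: (gN h x y) => //; right.
  + have Nt : N t.
      by apply: contrapT => nNt; case: tx => _; apply; exact: (gN t y x).
    by apply: (sy); apply: (gN h x t) => //; right.
  + by case: (Dt _ tx ty).
- by move=> /(_ _ Nx) [_ xx _]; case: oR => irr _; case: (irr x).
Qed.

(** The same overlap argument, with the union of the summands other than that of [x] as the module
    that contains [y] and [h] but not [x]. *)
Lemma span_cmp_sub N : anti (cmp R) x y -> order_module R N ->
  overlap_free N -> N x -> N y -> span (cmp R) x y `<=` N.
Proof.
move=> axy mN oN Nx Ny h Dh; apply: contrapT => nNh.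
have gN := order_module_graph mN; have sy := cograph_sym cr.
have irr := cograph_irr cr.
have yM : [/\ span (cmp R) x y y, anti (cmp R) x y & forall t,
   span (cmp R) x y t -> cmp R t x -> anti (cmp R) t y].
  split => // t Dt tx.
  case: (eq_or_adj_or_anti (cmp R) t y) => // [ty|ty].
    by case: axy => _ []; apply: (sy); rewrite -ty.
  by case: (irr t); exact: Dt.
have hM : [/\ span (cmp R) x y h, anti (cmp R) x h & forall t,
   span (cmp R) x y t -> cmp R t x -> anti (cmp R) t h].
  have hx : anti (cmp R) h x.
    case: (eq_or_adj_or_anti (cmp R) h x) => // hx.
      by case: nNh; rewrite hx.
    case: (irr h); apply: (Dh h hx); exact: (gN h x y).
  split => //; first exact: anti_sym.
  move=> t Dt tx; have [_ _ /(_ t Dt tx) ty] := yM.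
  have Nt : N t.
    by apply: contrapT => nNt; case: ty => _; apply; exact: (gN t x y).
  apply: anti_sym => //; exact: (graph_module_anti cr gN nNh Nx Nt).
case: (oN _ (other_part_module axy)); first by exists y.
- by move=> /(_ _ hM)/nNh.
- by move=> /(_ _ Nx) [_ []].
Qed.

End Parts.

Lemma span_anti_sub R x y N : strict_order R -> cograph (cmp R) -> cmp R x y ->
  order_module R N -> overlap_free R N -> N x -> N y ->
  span (anti (cmp R)) x y `<=` N.
Proof.
wlog Rxy : x y / R x y.
  move=> wl oR cr [Rxy|Ryx] mN oN Nx Ny h Dh.
    by apply: (wl x y) => //; left.
  apply: (wl y x) => //; first by left.
  by move=> w wy wx; exact: Dh.
move=> oR cr _ mN oN Nx Ny h Dh; apply: contrapT => nNh.
have gN := order_module_graph mN.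
have : cmp R h x.
  case: (eq_or_adj_or_anti (cmp R) h x) => // [hx|hx].
    by case: nNh; rewrite hx.
  by case: (Dh h hx (graph_module_anti cr gN nNh Nx Ny hx)).
case=> [hx|xh]; last by apply: nNh; exact: (span_anti_sub_upper oR cr Rxy).
case: oR => irr tr.
(* If [h] is below [x], it is below [y] as well, so the upper case applies in the reversed order
   with base point [y]. *)
apply: nNh; apply: (@span_anti_sub_upper (fun a b => R b a) y x) => //.
- by split => // a b c ab bc; exact: tr bc ab.
- by rewrite cmp_flip.
- by move=> z m m' nz Nm Nm'; have [] := mN _ _ _ nz Nm Nm'.
- move=> M mM; apply: oN => z m m' nz Mm Mm'.
  by have [] := mM _ _ _ nz Mm Mm'.
- by rewrite cmp_flip => w wy wx; exact: Dh.
- exact: tr Rxy.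
Qed.

End StrictOrders.

(** * Strong hulls in N-free posets *)

Section NFreePosets.
Variables (d : Order.disp_t) (X : porderType d).
Implicit Types (x y z : X) (M N : set X) (r : X -> X -> Prop).

Definition strict_comp : X -> X -> Prop := cmp (fun x y => (x < y)%O).

Lemma lt_strict_order : strict_order (fun x y : X => (x < y)%O).
Proof. by split=> [x|x y z]; [rewrite ltxx | exact: lt_trans]. Qed.

(** By transitivity the edges of an induced four-vertex path alternate in direction, so the path is
    an N read from one of its ends. *)
Lemma N_free_cograph : N_free X -> cograph strict_comp.
Proof.
move=> nf.
have noN a b c e : (a < b)%O -> (c < b)%O -> (c < e)%O ->
    anti strict_comp a c -> anti strict_comp b e -> anti strict_comp a e ->
    False.
  move=> ab cb ce [/eqP nac uac] [/eqP nbe ube] [/eqP nae uae].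
  have F x y : ~ strict_comp x y -> ((x < y)%O = false) * ((y < x)%O = false).
    by move=> n; split; apply/negP => h; apply: n; [left|right].
  have sne x y : x != y -> ((x == y) = false) * ((y == x) = false).
    by move=> n; rewrite [y == x]eq_sym (negbTE n).
  have slt x y : (x < y)%O ->
      ((x < y)%O = true) * ((y < x)%O = false) *
      ((x == y) = false) * ((y == x) = false).
    by move=> h; rewrite h lt_gtF// lt_eqF// gt_eqF.
  apply: nf; exists a, b, c, e; split.
    by rewrite /= !inE !negb_or (slt _ _ ab) (sne _ _ nac) (sne _ _ nae)
      (slt _ _ cb) (sne _ _ nbe) (slt _ _ ce).
  move=> x y; rewrite !inE !xpair_eqE.
  by move=> /or4P[]/eqP-> /or4P[]/eqP->;
    rewrite ?ltxx ?eqxx ?(slt _ _ ab) ?(slt _ _ cb) ?(slt _ _ ce)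
    ?(sne _ _ nac) ?(sne _ _ nbe) ?(sne _ _ nae)
    ?(F _ _ uac) ?(F _ _ ube) ?(F _ _ uae).
split.
- by move=> x []; rewrite ltxx.
- by move=> x y []; [right|left].
move=> a b c e [ab|ba] [bc|cb] [ce|ec] ac be ae.
- by case: ac => _ []; left; exact: lt_trans bc.
- by case: ac => _ []; left; exact: lt_trans bc.
- exact: noN ab cb ce ac be ae.
- by case: be => _ []; right; exact: lt_trans cb.
- by case: be => _ []; left; exact: lt_trans ce.
- have sw x y : anti strict_comp x y -> anti strict_comp y x.
    by case=> n u; split => [/esym//|[h|h]]; apply: u; [right|left].
  by apply: (noN e c b a) => //; exact: sw.
- by case: ac => _ []; right; exact: lt_trans ba.
- by case: ac => _ []; right; exact: lt_trans ba.
Qed.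

Lemma is_moduleP M : is_module M <-> order_module (fun x y => (x < y)%O) M.
Proof.
have lE x m : ~ M x -> M m ->
    ((x <= m)%O = (x < m)%O) * ((m <= x)%O = (m < x)%O).
  move=> nx Mm; have /negbTE nxm : x != m.
    by apply/eqP => xm; apply: nx; rewrite xm.
  by rewrite !le_eqVlt [m == x]eq_sym nxm; split.
split=> mM x m m' nx Mm Mm'.
  have [h h'] := mM x m m' nx Mm Mm'.
  by rewrite !(lE _ _ nx Mm) !(lE _ _ nx Mm') in h h'; split;
    [case: h|case: h'].
have [h1 h2] := mM x m m' nx Mm Mm'; have [h3 h4] := mM x m' m nx Mm' Mm.
by rewrite !(lE _ _ nx Mm) !(lE _ _ nx Mm').
Qed.

(* [strong_module] spells the intersection as the meet of the lattice of sets.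
  *)
Lemma strong_moduleP M : strong_module M <-> [/\ M !=set0, is_module M &
  forall N, is_module N -> N `&` M !=set0 -> N `<=` M \/ M `<=` N].
Proof.
split=> -[M0 mM sM]; split => // N mN.
  move=> [x NMx]; case: (sM N mN) => [NM0|NM|MN]; [|by left|by right].
  by have : set0 x by rewrite -NM0.
have [NM0|/set0P NM] := eqVneq (N `&` M) set0; first exact: Or31.
by case: (sM N mN NM) => h; [exact: Or32|exact: Or33].
Qed.

Hypothesis cX : cograph strict_comp.

(** Ranging over the graph and its complement lets levels of both types share one argument. *)
Definition comparability r := r = strict_comp \/ r = anti strict_comp.

Lemma comparability_cograph r : comparability r -> cograph r.
Proof. by case=> ->//; exact: anti_cograph. Qed.

Lemma is_module_graph r M : comparability r -> is_module M -> graph_module r M.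
Proof.
by move=> [->|->] /is_moduleP/order_module_graph//; exact: graph_module_anti.
Qed.

Lemma span_strong_module r x y : comparability r -> r x y ->
  strong_module (span (anti r) x y).
Proof.
move=> cr rxy; have cgr := comparability_cograph cr; apply/strong_moduleP;
  split.
- by exists x; exact: span_l.
- apply/is_moduleP; case: cr rxy => ->; last rewrite antiK//.
    exact: span_anti_order_module lt_strict_order cX.
  exact: span_cmp_order_module lt_strict_order cX.
- by move=> N mN; apply: span_strong => //; exact: is_module_graph cr mN.
Qed.

(** The span is a strong module, which bounds the hull from above; conversely every strong module
    through [x] and [y] is overlap-free, hence contains the span. *)
Lemma strong_hullE r x y : comparability r -> r x y ->
  strong_hull x y = span (anti r) x y.
Proof.
move=> cr rxy; apply/seteqP; split.
  apply: smallest_sub; first exact: span_strong_module.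
  by move=> z [->|->]; [exact: span_l|exact: span_r].
move=> h Dh M [/strong_moduleP[_ /is_moduleP mM sM] xyM].
suff : span (anti r) x y `<=` M by exact.
have [Mx My] : M x /\ M y by split; apply: xyM; [left|right].
have oM : overlap_free (fun x y => (x < y)%O) M.
  by move=> N mN; apply: sM; exact/is_moduleP.
case: cr rxy => ->; last rewrite antiK//.
  by move=> rxy; apply: span_anti_sub oM _ _ => //; exact: lt_strict_order.
by move=> rxy; apply: span_cmp_sub oM _ _ => //; exact: lt_strict_order.
Qed.

Lemma comparability_of x y : x <> y -> exists r, comparability r /\ r x y.
Proof.
case: (eq_or_adj_or_anti strict_comp x y) => // h _.
  by exists strict_comp; split => //; left.
by exists (anti strict_comp); split => //; right.
Qed.

Lemma strong_hull_strong x y : x <> y -> strong_module (strong_hull x y).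
Proof.
move=> /comparability_of[r [cr rxy]]; rewrite (strong_hullE cr rxy).
exact: span_strong_module.
Qed.

Lemma strong_hull_sub x y M : strong_module M -> M x -> M y ->
  strong_hull x y `<=` M.
Proof. by move=> sM Mx My; apply: smallest_sub => // z [->|->]. Qed.

Lemma strong_hull_l x y : strong_hull x y x.
Proof. by move=> M [_ h]; apply: h; left. Qed.

Lemma strong_hull_r x y : strong_hull x y y.
Proof. by move=> M [_ h]; apply: h; right. Qed.

Lemma strong_module_total M N x : strong_module M -> strong_module N ->
  M x -> N x -> M `<=` N \/ N `<=` M.
Proof.
move=> /strong_moduleP[_ mM _] /strong_moduleP[_ _ sN] Mx Nx.
by apply: sN => //; exists x.
Qed.

(** If [z] were incomparable to [x], membership in the hull of [x] and [y] would make it comparable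
    to [y]; then [y], in the hull of [x] and [z], would be comparable to itself. Hence the type of a
    level does not depend on its generator. *)
Lemma comp_strong_hull x y z : x <> y -> x <> z ->
  strong_hull x y = strong_hull x z -> strict_comp x y -> strict_comp x z.
Proof.
move=> nxy nxz yz xy; case: (eq_or_adj_or_anti strict_comp x z) => // xz.
have sy := cograph_sym cX.
have Ey := strong_hullE (or_introl erefl) xy.
have Ez := strong_hullE (or_intror erefl) xz.
rewrite antiK// in Ez.
have zy : strict_comp z y.
  have : span (anti strict_comp) x y z by rewrite -Ey yz; exact: strong_hull_r.
  move=> Dz; case: (eq_or_adj_or_anti strict_comp z y) => // [zy|zy].
    by case: xz => _ []; rewrite zy.
  by case: (Dz z (anti_sym cX xz) zy).
have : span strict_comp x z y by rewrite -Ez -yz; exact: strong_hull_r.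
by move=> /(_ y (sy _ _ xy) (sy _ _ zy))/(cograph_irr cX).
Qed.

End NFreePosets.

(** * Levels of an N-free ordered group *)

Section OrderedGroups.
Variables (d : Order.disp_t) (G : orderedGroupType d).
Local Open Scope group_scope.
Implicit Types (a b g h k w x y : G) (r : G -> G -> Prop).

Definition level g : set G := strong_hull 1 g.

Lemma mulg_lt2 a b x y : (x < y)%O -> (a * x * b < a * y * b)%O.
Proof.
rewrite !lt_neqAle => /andP[nxy xy]; rewrite mulg_le2// andbT.
by apply: contra nxy => /eqP/mulIg/mulgI->.
Qed.

Lemma comp_mulg2 a b x y :
  strict_comp x y -> strict_comp (a * x * b) (a * y * b).
Proof. by case=> h; [left|right]; exact: mulg_lt2. Qed.

Lemma comparability_mulg2 r a b x y :
  comparability r -> r x y -> r (a * x * b) (a * y * b).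
Proof.
case=> ->; first exact: comp_mulg2.
case=> nxy nc; split; first by move=> /mulIg/mulgI.
by move=> /(comp_mulg2 a^-1 b^-1); rewrite -!mulgA !mulgV !mulg1 !mulKg.
Qed.

Lemma comparability_mulgl r a x y :
  comparability r -> r x y -> r (a * x) (a * y).
Proof. by move=> cr /(comparability_mulg2 a 1 cr); rewrite !mulg1. Qed.

Lemma comparability_mulgr r b x y :
  comparability r -> r x y -> r (x * b) (y * b).
Proof. by move=> cr /(comparability_mulg2 1 b cr); rewrite !mul1g. Qed.

Hypothesis cG : cograph (@strict_comp d G).

Lemma comparability_anti r : comparability r -> comparability (anti r).
Proof. by case=> ->; [right|left; rewrite antiK]. Qed.

Lemma span_mulgl r a x y z : comparability r ->
  span (anti r) x y z -> span (anti r) (a * x) (a * y) (a * z).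
Proof.
move=> /comparability_anti cr Dz w wx wy.
rewrite -[w](mulVKg a); apply: comparability_mulgl => //.
by apply: Dz; rewrite -[X in anti r _ X](mulKg a); exact: comparability_mulgl.
Qed.

Lemma levelE r g : comparability r -> r 1 g -> level g = span (anti r) 1 g.
Proof. exact: strong_hullE. Qed.

Lemma comparability1 g : g != 1 -> exists r, comparability r /\ r 1 g.
Proof. by move=> g1; apply: comparability_of => /esym/eqP; apply/negP. Qed.

Lemma level1 g : level g 1. Proof. exact: strong_hull_l. Qed.
Lemma level_id g : level g g. Proof. exact: strong_hull_r. Qed.

Lemma level_strong g : g != 1 -> strong_module (level g).
Proof. by move=> g1; apply: strong_hull_strong => // /esym/eqP; apply/negP. Qed.

Lemma level_sub g h : h != 1 -> level h g <-> level g `<=` level h.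
Proof.
move=> h1; split; last by apply; exact: level_id.
by move=> hg; apply: strong_hull_sub => //; [exact: level_strong|exact: level1].
Qed.

Lemma level_total g h : g != 1 -> h != 1 ->
  level g `<=` level h \/ level h `<=` level g.
Proof.
by move=> g1 h1; apply: (@strong_module_total _ _ _ _ 1);
  [exact: level_strong|exact: level_strong|exact: level1|exact: level1].
Qed.

Lemma level_graph_module r g : comparability r -> g != 1 ->
  graph_module r (level g).
Proof. by move=> cr g1; apply: is_module_graph => //;
  case: (level_strong g1). Qed.

(** A witness [w] against membership, if joined to [a^-1], gives the induced path [w], [a * w], [1],
    [a]: the relations not given are translates of [r 1 a], [r w a^-1] and [anti r w 1]. *)
Lemma invg_level a : a != 1 -> level a a^-1.
Proof.
move=> a1; have [r [cr r1a]] := comparability1 a1.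
have cgr := comparability_cograph cG cr.
have car := comparability_anti cr.
rewrite (levelE cr r1a) => w w1 wa.
case: (eq_or_adj_or_anti r w a^-1) => // wE; exfalso.
  case: w1 => _; apply; rewrite wE.
  by rewrite -[X in r X _]mulg1 -[X in r _ X](mulVg a);
    exact: comparability_mulgl.
apply: (@cograph_P4 _ _ cgr w (a * w) 1 a) => //.
- by rewrite -[X in r X _]mul1g; exact: comparability_mulgr.
- by rewrite -[X in r _ X](mulgV a); exact: comparability_mulgl.
- by rewrite -[X in anti r _ X](mulg1 a); exact: comparability_mulgl.
Qed.

Lemma level_inv a : level a^-1 = level a.
Proof.
have [->|a1] := eqVneq a 1; first by rewrite invg1.
have a'1 : a^-1 != 1 by rewrite invg_eq1.
apply/seteqP; split; first by apply/level_sub => //; exact: invg_level.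
by apply/(level_sub _ a'1); rewrite -{2}[a]invgK; exact: invg_level.
Qed.

(** [level a] is also the span of [1] and [a^-1], which left translation by [a] carries into the
    span of [a] and [1]. *)
Lemma level_mulg_self a x : level a x -> level a (a * x).
Proof.
have [->|a1] := eqVneq a 1; first by rewrite mul1g.
have [r [cr r1a]] := comparability1 a1.
rewrite -{1}level_inv (levelE cr r1a) (levelE (g := a^-1) cr); last first.
  apply: (cograph_sym (comparability_cograph cG cr)).
  by rewrite -[X in r X _]mulg1 -[X in r _ X](mulVg a);
    exact: comparability_mulgl.
by move=> /(span_mulgl (a := a) cr); rewrite mulg1 mulgV spanC.
Qed.

(* A witness w that a * m is outside the level of m would close an induced
   four-vertex path: on m, 1, a * m, w or on 1, m, a^-1 * w, w, according to how
   a * m is related to m. *)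
Lemma level_mulg_out a m : a != 1 -> m != 1 -> ~ level a m -> level m (a * m).
Proof.
move=> a1 m1 nam; have [r [cr r1m]] := comparability1 m1.
have cgr := comparability_cograph cG cr.
have car := comparability_anti cr.
have sy := cograph_sym cgr; have asy x y := @anti_sym _ r x y cgr.
have modr := level_graph_module cr a1.
have noutam : ~ level a (a * m).
  rewrite -level_inv => /level_mulg_self; rewrite mulKg level_inv; exact: nam.
have rm1 := sy _ _ r1m.
have ram1 : r (a * m) 1.
  apply: (modr _ a 1) => //; [exact: level_id|exact: level1|].
  by rewrite -[X in r _ X]mulg1; exact: comparability_mulgl.
rewrite (levelE cr r1m) => w w1 wm.
case: (eq_or_adj_or_anti r w (a * m)) => // wE; exfalso.
  by case: w1 => _; apply; rewrite wE.
(* Were [w] in the module [level a], the outside point [m] would be joined to it as it is to [1]. *)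
have nw : ~ level a w.
  move=> aw; case: wm => _; apply; apply: (sy); apply: (modr _ 1 w) => //.
  exact: level1.
have aw' : anti r (a^-1 * w) 1.
  rewrite -[X in anti r _ X](mulVg a); apply: comparability_mulgl => //.
  apply: (level_graph_module car a1 (m := 1)) => //.
  - exact: level1.
  - exact: level_id.
case: (eq_or_adj_or_anti r (a * m) m) => amm.
- by move: amm; rewrite -[X in _ = X]mul1g => /mulIg/eqP; apply/negP.
- have ra1 : r a 1.
    by rewrite -(mulgK m a) -[X in r _ X](mulgV m); exact: comparability_mulgr.
  apply: (@cograph_P4 _ _ cgr 1 m (a^-1 * w) w) => //.
  + by rewrite -[X in r X _](mulKg a); apply: comparability_mulgl => //;
      exact: sy.
  + rewrite -[X in r _ X]mul1g; apply: comparability_mulgr => //.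
    apply: (sy); rewrite -[X in r X _](mulVg a) -[X in r _ X]mulg1.
    exact: comparability_mulgl.
  + exact: asy.
  + exact: asy.
  + exact: asy.
- apply: (@cograph_P4 _ _ cgr m 1 (a * m) w) => //.
  + exact: sy.
  + exact: sy.
  + exact: asy.
  + exact: asy.
  + exact: asy.
Qed.

(** The product lies in [level x] if [y] does, and in [level y] otherwise; both are inside
    [level g]. *)
Lemma level_mulg g x y : g != 1 -> level g x -> level g y -> level g (x * y).
Proof.
move=> g1 gx gy.
have [->|x1] := eqVneq x 1; first by rewrite mul1g.
have [->|y1] := eqVneq y 1; first by rewrite mulg1.
have [xy|nxy] := pselect (level x y).
  by apply: (_ : level x `<=` level g);
    [exact/level_sub|exact: level_mulg_self].
by apply: (_ : level y `<=` level g); [exact/level_sub|exact: level_mulg_out].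
Qed.

Lemma level_invg g x : g != 1 -> level g x -> level g x^-1.
Proof.
move=> g1 /(level_sub _ g1) xg; apply: xg; rewrite -level_inv; exact: level_id.
Qed.

Lemma comp_level g h : g != 1 -> h != 1 -> level g = level h ->
  strict_comp 1 g -> strict_comp 1 h.
Proof.
by move=> g1 h1; apply: comp_strong_hull => // /esym/eqP; apply/negP.
Qed.

Lemma level_out_comparable r g h : comparability r -> g != 1 -> ~ level g h ->
  r h g <-> r h 1.
Proof.
move=> cr g1 nh; split; apply: (level_graph_module cr g1 nh).
- exact: level_id.
- exact: level1.
- exact: level1.
- exact: level_id.
Qed.

(** * The subgroup [lower H] and the type of a level *)

Lemma canonical_chainP (H : set G) :
  canonical_chain G H <-> exists2 g, g != 1 & H = level g.
Proof. by split=> [[g g1 <-]|[g g1 ->]]; exists g. Qed.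

Lemma lowerP (H : set G) x : lower H x <-> x = 1 \/ x != 1 /\ level x `<` H.
Proof.
split=> [[->|[L [/canonical_chainP[g g1 ->] gH] gx]]|[->|[x1 xH]]];
  first by left.
- have [->|x1] := eqVneq x 1; first by left.
  right; split => //; apply: subset_proper_trans gH; exact/level_sub.
- by left.
- by right; exists (level x); [split => //; exists x|exact: level_id].
Qed.

Lemma lower_mulg (H : set G) x y : lower H x -> lower H y -> lower H (x * y).
Proof.
move=> /lowerP[->|[x1 xH]] /lowerP Hy; first by rewrite mul1g; exact/lowerP.
case: Hy => [->|[y1 yH]]; first by rewrite mulg1; apply/lowerP; right.
apply/lowerP; have [->|xy1] := eqVneq (x * y) 1; [by left|right; split => //].
have [xy|yx] := level_total x1 y1.
  apply: subset_proper_trans yH; apply/level_sub => //; apply: level_mulg => //.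
  - exact/level_sub.
  - exact: level_id.
apply: subset_proper_trans xH; apply/level_sub => //; apply: level_mulg => //.
- exact: level_id.
- exact/level_sub.
Qed.

Lemma lower_invg (H : set G) x : lower H x -> lower H x^-1.
Proof.
move=> /lowerP[->|[x1 xH]]; first by rewrite invg1; left.
by apply/lowerP; right; rewrite invg_eq1 level_inv.
Qed.

(** The type read off a generator; [level_has_type] and [has_type_uniq] identify it with the type of
    [level g]. *)
Definition type_of g : level_type :=
  if `[< strict_comp 1 g >] then TypeC else TypeA.

Lemma level_lower g x : g != 1 -> x != 1 -> level g x -> ~ lower (level g) x ->
  level x = level g.
Proof.
move=> g1 x1 gx nx; apply/seteqP; split; first exact/level_sub.
apply: contrapT => ngx; apply: nx; apply/lowerP; right; split => //.
by split => //; exact/level_sub.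
Qed.

Lemma not_lower_self g : g != 1 -> ~ lower (level g) g.
Proof. by move=> /eqP g1 /lowerP[//|[_ []]]. Qed.

Lemma coset_lower (H : set G) x y : lower H (x^-1 * y) ->
  [set x * n | n in lower H] = [set y * n | n in lower H].
Proof.
move=> Hxy; apply/seteqP; split=> _ [n Hn <-].
  exists ((x^-1 * y)^-1 * n); first by apply: lower_mulg => //;
    exact: lower_invg.
  by rewrite invgM invgK !mulgA mulgV mul1g.
exists (x^-1 * y * n); first exact: lower_mulg.
by rewrite !mulgA mulgV mul1g.
Qed.

(** An element of [level g] outside [lower (level g)] generates the same level, so it is comparable
    to [1] exactly when [g] is. Comparing two cosets reduces by translation to comparing such an
    element with [1]. *)
Lemma level_has_type g : g != 1 -> has_type (level g) (type_of g).
Proof.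
move=> g1; rewrite /type_of; case: asboolP => [cg|ncg] _ _ [x gx <-] [y gy <-];
  have gz : level g (x^-1 * y) by apply: level_mulg => //; exact: level_invg.
- have [z_low|z_low] := pselect (lower (level g) (x^-1 * y)).
    left; exists y, y; split => //; last by exists 1; [left|rewrite mulg1].
    by exists (x^-1 * y) => //; rewrite mulgA mulgV mul1g.
  have z1 : x^-1 * y != 1 by apply/eqP => zE; apply: z_low; rewrite zE; left.
  have /esym := level_lower g1 z1 gz z_low.
  move=> /(comp_level g1 z1)/(_ cg)/(comparability_mulgl x (or_introl erefl)).
  rewrite mulg1 mulgA mulgV mul1g.
  by case=> /ltW xy; [left|right]; [exists x, y|exists y, x];
    split=> //; exists 1; rewrite ?mulg1//; left.
- split=> [[_ [_ [[n ln <-] [m lm <-] le]]]|->]; last first.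
    by exists y, y; split => //; exists 1; rewrite ?mulg1//; left.
  (* The inequality between the representatives [x * n] and [y * m] becomes [1 <= z]. *)
  apply: coset_lower; set z := n^-1 * (x^-1 * y) * m.
  suff lz : lower (level g) z.
    rewrite (_ : x^-1 * y = n * z * m^-1); last first.
      by rewrite /z !mulgA mulgV mul1g -!mulgA mulgV mulg1.
    by do !apply: lower_mulg => //; exact: lower_invg.
  have lowg u : lower (level g) u -> level g u.
    move=> /lowerP[->|[u1 [ug _]]]; first exact: level1.
    by apply: ug; exact: level_id.
  apply: contrapT => nz.
  have z1 : z != 1 by apply/eqP => zE; apply: nz; rewrite zE; left.
  have gz' : level g z.
    apply: level_mulg => //; last exact: lowg.
    by apply: level_mulg => //; apply: level_invg => //; exact: lowg.
  apply: ncg; apply: (comp_level z1 g1); first exact: level_lower.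
  left; rewrite lt_neqAle eq_sym z1 /=.
  have := mulg_le2 (x * n)^-1 1 _ _ le.
  by rewrite !mulg1 mulVg invgM /z !mulgA.
Qed.

(** With both types, the cosets of [1] and [g] would be comparable, hence equal, putting [g] into
    [lower (level g)]. *)
Lemma has_type_uniq g t : g != 1 -> has_type (level g) t -> t = type_of g.
Proof.
move=> g1; have := level_has_type g1; set H := level g.
have qg x : level g x ->
    level_quotient H [set x * n | n in lower H] by exists x.
have q1 := qg 1 (@level1 g); have qgg := qg g (@level_id g).
suff excl : has_type H TypeC -> has_type H TypeA -> False.
  by case: (type_of g) t => -[] // h1 h2; case: excl.
move=> hC hA.
have : [set 1 * n | n in lower H] = [set g * n | n in lower H].
  by case: (hC _ _ q1 qgg) => [/(hA _ _ q1 qgg)|/(hA _ _ qgg q1)].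
have gg : [set g * n | n in lower H] g by exists 1; [left|rewrite mulg1].
move=> E; move: gg; rewrite -E => -[n ln]; rewrite mul1g => ng.
by apply: (not_lower_self g1); rewrite -[X in lower _ X]ng.
Qed.

Lemma same_typeP g h : g != 1 -> h != 1 ->
  same_type (level g) (level h) <-> type_of g = type_of h.
Proof.
move=> g1 h1; split=> [[t [/has_type_uniq<-// /has_type_uniq<-//]]|gh].
by exists (type_of g); split; [|rewrite gh]; exact: level_has_type.
Qed.

Lemma type_of_level g h : g != 1 -> h != 1 -> level g = level h ->
  type_of g = type_of h.
Proof.
by move=> g1 h1 gh; apply: has_type_uniq => //; rewrite -gh;
  exact: level_has_type.
Qed.

End OrderedGroups.

(** * Levels of a subgroup *)

Section InducedLevels.
Variables (d : Order.disp_t) (G : orderedGroupType d) (K : groupClosed G).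
Local Open Scope group_scope.
Hypothesis cG : cograph (@strict_comp d G).
Implicit Types (h k l w : induced K).

Lemma comp_val k h : strict_comp (val k) (val h) <-> strict_comp k h.
Proof. by rewrite /strict_comp /cmp !ltEsub. Qed.

Lemma anti_comp_val k h :
  anti (@strict_comp d G) (val k) (val h) <-> anti (@strict_comp d _) k h.
Proof.
split=> -[nkh nc]; split.
- by move=> kh; apply: nkh; rewrite kh.
- by move=> /comp_val.
- by move=> /val_inj.
- by move=> /comp_val.
Qed.

Lemma cograph_induced : cograph (@strict_comp d (induced K)).
Proof.
split=> [k /comp_val|k h /comp_val kh|a b c e].
- exact: cograph_irr cG _.
- by apply/comp_val; exact: cograph_sym cG _ _ kh.
- move=> /comp_val ab /comp_val bc /comp_val ce.
  move=> /anti_comp_val ac /anti_comp_val be /anti_comp_val ae.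
  exact: (cograph_P4 cG ab bc ce).
Qed.
Let cK := cograph_induced.

Lemma val_eq1 k : (val k == 1) = (k == 1).
Proof. by rewrite -(inj_eq val_inj). Qed.

Definition glevel k : set G := level (val k).

Lemma type_of_val k : type_of (val k) = type_of k.
Proof.
by rewrite /type_of (asbool_equiv_eq (comp_val 1 k)).
Qed.

Lemma type_of_comparability (H : orderedGroupType d) (r : H -> H -> Prop)
    (g h : H) :
  cograph (@strict_comp d H) -> comparability r -> r 1 g -> h != 1 ->
  type_of g = type_of h <-> r 1 h.
Proof.
move=> cH [->|->] r1g h1; rewrite /type_of.
  by rewrite asboolT//; case: asboolP.
have [n1g ng] := r1g.
rewrite (asboolF ng); case: asboolP => ch; first by split => // -[].
by split => // _; split => //; apply/eqP; rewrite eq_sym.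
Qed.

(** Matching relations on [G] and [K], so that the span formula for the level of [k] can be compared
    in the two groups. *)
Lemma induced_comparability k : k != 1 -> exists r rK,
  [/\ comparability r, comparability rK, r 1 (val k) &
      forall x y : induced K, rK x y <-> r (val x) (val y)].
Proof.
move=> k1; have /eqP n1k : 1 != k by rewrite eq_sym.
have n1k' : 1 != val k by rewrite eq_sym val_eq1.
case: (eq_or_adj_or_anti (@strict_comp d _) 1 (val k)) => [E|c|a].
- by rewrite -E eqxx in n1k'.
- exists (@strict_comp d _), (@strict_comp d _); split => //; by left.
- exists (anti (@strict_comp d _)), (anti (@strict_comp d _)); split;
    [by right|by right|by []|].
  by move=> x y; split=> /anti_comp_val.
Qed.

Lemma glevel_total k h : k != 1 -> h != 1 ->
  glevel k `<=` glevel h \/ glevel h `<=` glevel k.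
Proof. by move=> k1 h1; apply: level_total => //; rewrite val_eq1. Qed.

Lemma glevel_sub k h : h != 1 -> glevel h (val k) <-> glevel k `<=` glevel h.
Proof. by move=> h1; apply: level_sub => //; rewrite val_eq1. Qed.

Lemma type_of_glevel k h : k != 1 -> h != 1 ->
  glevel k `<=` glevel h -> glevel h `<=` glevel k -> type_of k = type_of h.
Proof.
move=> k1 h1 kh hk; rewrite -!type_of_val; apply: type_of_level => //.
exact/seteqP.
Qed.

(* A met level of the other type lying weakly between those of k and k' provides
   the witness that separates k' from 1 and k; conversely, the ambient level of
   such a witness is of that kind. *)
Lemma induced_levelP k k' : k != 1 -> k' != 1 ->
  level k k' <-> forall w, w != 1 -> glevel k `<=` glevel w ->
    glevel w `<=` glevel k' -> type_of w = type_of k.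
Proof.
move=> k1 k'1; have [r [rK [cr crK r1k rE]]] := induced_comparability k1.
have cgr := comparability_cograph cG cr.
have car := comparability_anti cG cr.
have n1 (x : induced K) : x != 1 -> val x != 1 by rewrite val_eq1.
have aE x y : anti rK x y <-> anti r (val x) (val y).
  split=> -[xy nr]; split.
  - by move=> /val_inj.
  - by move=> /rE.
  - by move=> exy; apply: xy; rewrite exy.
  - by move=> /rE.
have rK1k : rK 1 k by apply/rE.
have asy x y := @anti_sym _ r x y cgr.
have tyP w : w != 1 -> type_of w = type_of k <-> r 1 (val w).
  move=> w1; rewrite -(type_of_comparability cG cr r1k (n1 _ w1)) !type_of_val.
  by split=> ->.
have tyN w : w != 1 -> type_of w <> type_of k -> anti r (val w) 1.
  move=> w1 wk; apply: asy; split; last by move/tyP => /(_ w1).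
  by apply/eqP; rewrite eq_sym n1.
rewrite (levelE cK crK rK1k); split.
- move=> Dk' w w1 kw wk'; apply: contrapT => nwk.
  have aw1 := tyN _ w1 nwk.
  have nkw : ~ glevel k (val w).
    by move=> /(glevel_sub _ k1) wk; apply: nwk; exact: type_of_glevel.
  have awk : anti r (val w) (val k).
    exact: (iffRL (level_out_comparable cG car (n1 _ k1) nkw)).
  have awk' : anti r (val w) (val k') by apply/aE; apply: Dk'; apply/aE.
  (* If [k'] has the type of [k], it lies outside the level of [w], so it is joined to [w] as it is
     to [1], against [awk']. *)
  have [/tyP|tk'] := pselect (type_of k' = type_of k).
    move=> /(_ k'1) r1k'.
    have nk'w : ~ glevel w (val k').
      move=> /(glevel_sub _ w1) k'w; apply: nwk;
        apply: etrans (iffRL (tyP _ k'1) r1k').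
      exact: type_of_glevel.
    have /(iffRL (level_out_comparable cG cr (n1 _ w1) nk'w)) : r (val k') 1.
      exact: cograph_sym cgr _ _ r1k'.
    by move=> /(cograph_sym cgr); case: awk'.
  (* Otherwise [k'] is itself a witness: anti-related to [1] and [k], hence by [Dk'] to itself. *)
  have ak'1 := tyN _ k'1 tk'.
  have nkk' : ~ glevel k (val k').
    move=> /(glevel_sub _ k1) k'k; apply: tk'; apply: type_of_glevel => //.
    exact: subset_trans kw wk'.
  have ak'k : anti r (val k') (val k).
    exact: (iffRL (level_out_comparable cG car (n1 _ k1) nkk')).
  by case: (Dk' k'); [exact/aE|exact/aE|].
- move=> hw w /aE aw1 /aE awk; apply/aE.
  have w1 : w != 1 by rewrite -val_eq1; apply/eqP; case: aw1.
  (* Inside the level of [k], [w] would be anti-related to itself. So its level contains that of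
     [k], and [hw] then keeps [w] out of the level of [k']. *)
  have nkw : ~ glevel k (val w).
    by rewrite /glevel (levelE cG cr r1k) => /(_ _ aw1 awk) [].
  have kw : glevel k `<=` glevel w.
    by case: (glevel_total k1 w1) => // /(glevel_sub _ k1).
  have nk'w : ~ glevel k' (val w).
    move=> /(glevel_sub _ k'1) /(hw _ w1 kw) /(tyP _ w1) r1w.
    by case: (asy _ _ aw1).
  exact: (iffRL (level_out_comparable cG car (n1 _ k'1) nk'w)).
Qed.

(** * Blocks of met levels *)

Lemma met_levelsP (L : set G) :
  met_levels K L <-> exists2 k, k != 1 & L = glevel k.
Proof.
split=> [[g [gK g1] <-]|[k k1 ->]]; last first.
  by exists (val k) => //; split; [exact: (valP k)|rewrite val_eq1].
by exists (Sub g gK) => //; rewrite -val_eq1.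
Qed.

Lemma glevel_has_type k t : k != 1 -> has_type (glevel k) t <-> t = type_of k.
Proof.
move=> k1; have k1' : val k != 1 by rewrite val_eq1.
split=> [/(has_type_uniq cG k1')->|->]; first exact: type_of_val.
by rewrite -type_of_val; exact: level_has_type.
Qed.

(** The two disjuncts cover both possible orders of the levels; the classes of this relation turn
    out to be the blocks. *)
Definition linked k h := forall w, w != 1 ->
  (glevel k `<=` glevel w /\ glevel w `<=` glevel h) \/
  (glevel h `<=` glevel w /\ glevel w `<=` glevel k) -> type_of w = type_of k.

Definition link_class k : set (set G) :=
  [set glevel h | h in [set h | h != 1 /\ linked k h]].

Lemma linked_refl k : k != 1 -> linked k k.
Proof. by move=> k1 w w1 [] [kw wk]; exact: type_of_glevel. Qed.

Lemma link_classP k h : h != 1 -> link_class k (glevel h) <-> linked k h.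
Proof.
move=> h1; split=> [[h' [h'1 kh'] E]|kh]; last by exists h.
by move=> w w1; rewrite -E; exact: kh'.
Qed.

Lemma link_class_id k : k != 1 -> link_class k (glevel k).
Proof. by move=> k1; exists k => //; split => //; exact: linked_refl. Qed.

Lemma linked_type k h : h != 1 -> linked k h -> k != 1 -> type_of h = type_of k.
Proof.
move=> h1 kh k1; apply: kh => //.
by case: (glevel_total k1 h1) => lekh; [left|right]; split.
Qed.

Lemma link_class_typed_convex k : k != 1 -> typed_convex K (link_class k).
Proof.
move=> k1; split.
- by exists (glevel k); exact: link_class_id.
- split; first by move=> _ [h [h1 _] <-]; apply/met_levelsP; exists h.
  move=> _ _ _ [h [h1 kh] <-] [h' [h'1 kh'] <-] /met_levelsP[l l1 ->] hl lh'.
  apply/link_classP => // w w1 [[kw wl]|[lw wk]].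
    by apply: kh' => //; left; split => //; exact: subset_trans wl lh'.
  by apply: kh => //; right; split => //; exact: subset_trans hl lw.
- exists (type_of k) => _ [h [h1 kh] <-].
  by apply/glevel_has_type => //; rewrite (linked_type h1 kh).
Qed.

(** Convexity puts every met level between two members into [B], where the type is constant. So
    [link_class k] is the largest typed convex set through [glevel k]. *)
Lemma typed_convex_sub k B : k != 1 -> typed_convex K B -> B (glevel k) ->
  B `<=` link_class k.
Proof.
move=> k1 [_ [Bmet convB] [t tB]] Bk L BL.
have /met_levelsP[l l1 LE] := Bmet _ BL; rewrite LE in BL *.
apply/link_classP => // w w1 H.
suff Bw : B (glevel w).
  by rewrite -(iffLR (glevel_has_type _ w1) (tB _ Bw))
    -(iffLR (glevel_has_type _ k1) (tB _ Bk)).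
have mw : met_levels K (glevel w) by apply/met_levelsP; exists w.
by case: H => -[]; [exact: convB|exact: convB].
Qed.

Lemma link_class_block k : k != 1 -> blocks K (link_class k).
Proof.
move=> k1; split; first exact: link_class_typed_convex.
move=> B tB kB; apply/seteqP; split => //; apply: typed_convex_sub => //.
by apply: kB; exact: link_class_id.
Qed.

Lemma block_link_class k B : k != 1 -> blocks K B -> B (glevel k) ->
  B = link_class k.
Proof.
move=> k1 [tB maxB] Bk; apply/esym/maxB; first exact: link_class_typed_convex.
exact: typed_convex_sub.
Qed.

Lemma blocksP B : blocks K B <-> exists2 k, k != 1 & B = link_class k.
Proof.
split=> [bB|[k k1 ->]]; last exact: link_class_block.
have [[[L BL] [Bmet _] _] _] := bB.
have /met_levelsP[k k1 LE] := Bmet _ BL.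
by exists k => //; apply: block_link_class => //; rewrite -LE.
Qed.

Lemma block_of_glevel k : k != 1 -> block_of K (glevel k) = link_class k.
Proof.
move=> k1; rewrite /block_of; set P := [set B | _].
have Pk : P (link_class k).
  by split; [exact: link_class_block|exact: link_class_id].
by have [bB Bk] := xgetPex set0 (ex_intro _ _ Pk); exact: block_link_class.
Qed.

(** The criterion is the half of [linked k k'] with [glevel k] as lower end. If the other half
    fails, a level of another type separates the two blocks. *)
Lemma block_leP k k' : k != 1 -> k' != 1 ->
  block_le (link_class k') (link_class k) <->
  forall w, w != 1 -> glevel k `<=` glevel w -> glevel w `<=` glevel k' ->
    type_of w = type_of k.
Proof.
move=> k1 k'1; split.
  move=> le w w1 kw wk'; case: le => [E|lt].
    have /link_classP : link_class k (glevel k').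
      by rewrite -E; exact: link_class_id.
    by apply => //; left.
  have [_ []] := lt _ _ (link_class_id k'1) (link_class_id k1);
    exact: subset_trans kw wk'.
move=> noW; have [kk'|nkk'] := pselect (linked k k').
  left; apply/esym/block_link_class => //; first exact: link_class_block.
  exact/link_classP.
right; have [w [w1 k'w wk tw]] : exists w, [/\ w != 1, glevel k' `<=` glevel w,
    glevel w `<=` glevel k & type_of w <> type_of k].
  apply: contrapT => nw; apply: nkk' => w w1 [[kw wk']|[k'w wk]].
    exact: noW.
  by apply: contrapT => tw; apply: nw; exists w.
move=> _ _ [h [h1 k'h] <-] [l [l1 kl] <-].
suff nlh : ~ (glevel l `<=` glevel h).
  by split => //; case: (glevel_total h1 l1).
move=> lh; have tl := linked_type l1 kl k1.
(* Either [w] lies between [l] and [k], or both [w] and [l] lie between [k'] and [h]; each gives [w]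
   the type of [k]. *)
case: (glevel_total l1 w1) => [lw|wl].
  by apply: tw; apply: kl => //; right.
apply: tw; rewrite -tl.
rewrite (k'h w w1); last by left; split => //; exact: subset_trans wl lh.
by rewrite (k'h l l1)//; left; split => //; exact: subset_trans k'w wl.
Qed.

(** [block_leP] and [induced_levelP] give the same criterion. *)
Lemma block_level_link_class k : k != 1 ->
  block_level K (link_class k) = level k.
Proof.
move=> k1; apply/seteqP; split=> k'.
  move=> [->|[k'1]]; first exact: level1.
  by rewrite block_of_glevel// => /block_leP-/(_ k1 k'1) H;
    apply/induced_levelP.
have [->|k'1] := eqVneq k' 1; first by left.
move=> kk'; right; split => //; rewrite block_of_glevel//.
by apply/block_leP => //; apply/induced_levelP.
Qed.

End InducedLevels.

(** * Coalescing finitely many levels *)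

Section Runs.
Variables (T : Type) (x0 : T) (r : rel T).

Lemma runs_flatten s : flatten (runs r s) = s.
Proof.
elim: s => //= x s IH; case: (runs r s) IH => [|[|y b] bs] /=.
- by move=> <-.
- by move=> ->.
- by case: ifP => _ <-.
Qed.

Lemma runs_nonempty s : all (fun b => ~~ nilp b) (runs r s).
Proof.
elim: s => //= x s; case: (runs r s) => [|[|y b] bs] //=.
by case: ifP.
Qed.

Lemma runs_sorted s : all (sorted r) (runs r s).
Proof.
elim: s => //= x s; case: (runs r s) => [|[|y b] bs] //=.
by case: ifP => //= ->.
Qed.

Lemma runs_separated s :
  sorted (fun b b' => ~~ r (last x0 b) (head x0 b')) (runs r s).
Proof.
(* Nonemptiness excludes an empty first run, whose head would be the default [x0]. *)
elim: s => //= x s; have := runs_nonempty s.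
case: (runs r s) => [|[|y b] bs] //= _.
by case: ifP => [_|/= ->] //; case: bs.
Qed.

End Runs.

(** * Finite chains as strictly increasing sequences *)

Section ChainEnumeration.
Variable T : Type.

Definition proper_rel : rel (set T) := fun A B => `[< A `<` B >].

Lemma enumeratesP (s : seq (set T)) (A : set (set T)) :
  enumerates s A <-> [set` s] = A /\ pairwise proper_rel s.
Proof.
split=> -[sA ls]; split => //.
  apply/(pairwiseP set0) => i j _ js ij; apply/asboolP.
  by apply: ls; rewrite ij.
move=> i j /andP[ij js]; apply/asboolP/(pairwiseP set0 ls) => //.
by rewrite inE; exact: ltn_trans js.
Qed.

(** Sorting by inclusion, which is total only on [A], gives a weakly increasing sequence; removing
    duplicates makes it strict. *)
Lemma finite_chain_enumerates (A : set (set T)) : finite_set A ->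
  (forall M N, A M -> A N -> M `<=` N \/ N `<=` M) ->
  exists s, enumerates s A.
Proof.
move=> /finite_seqP[s0 ->] tot.
pose le : rel (set T) := fun M N => `[< M `<=` N >].
have le_tr : transitive le.
  by move=> y x z /asboolP xy /asboolP yz; apply/asboolP;
    exact: subset_trans yz.
exists (sort le (undup s0)); apply/enumeratesP; split.
  by apply/seteqP; split=> x /=; rewrite mem_sort mem_undup.
have : pairwise le (sort le (undup s0)).
  rewrite -(sorted_pairwise le_tr).
  apply: (@sort_sorted_in _ [in s0]) => [x y xs ys|].
    by apply/orP; case: (tot x y xs ys) => h; [left|right]; apply/asboolP.
  by apply/allP => x; rewrite mem_undup.
have : uniq (sort le (undup s0)) by rewrite sort_uniq undup_uniq.
rewrite uniq_pairwise => un le_s.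
have : pairwise [rel x y | (x != y) && le x y] (sort le (undup s0)).
  by rewrite pairwise_relI un.
apply: sub_pairwise => x y /andP[/eqP xy /asboolP lexy]; apply/asboolP;
  split => //.
by move=> yx; apply: xy; apply/seteqP.
Qed.

End ChainEnumeration.

(** * Runs of met levels and the canonical chain of the subgroup *)

Section Coalescing.
Variables (d : Order.disp_t) (G : orderedGroupType d) (K : groupClosed G).
Local Open Scope group_scope.
Hypothesis cG : cograph (@strict_comp d G).
Implicit Types (h k l w : induced K) (L H : set G) (b c : seq (set G)).

Let st : rel (set G) := fun H L => `[< same_type H L >].

Variable s : seq (set G).
Hypotheses (met_s : [set` s] = met_levels K)
  (lt_s : pairwise (@proper_rel G) s).

Lemma mem_metP L : L \in s <-> exists2 k : induced K, k != 1 & L = glevel k.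
Proof.
have -> : (L \in s : Prop) = met_levels K L by rewrite -met_s.
exact: met_levelsP.
Qed.

(** Restricted to [s] because transitivity rests on uniqueness of types: the set [[set 1]], which is
    not a level, has both. *)
Lemma st_trans : {in s & &, transitive st}.
Proof.
have tP k h : k != 1 -> h != 1 ->
    st (glevel k) (glevel h) <-> type_of k = type_of h.
  move=> k1 h1; rewrite -(type_of_val k) -(type_of_val h) -same_typeP//.
  by split=> /asboolP.
move=> _ _ _ /mem_metP[k k1 ->] /mem_metP[h h1 ->] /mem_metP[l l1 ->].
by move=> /tP-/(_ h1 k1) hk /tP-/(_ k1 l1) kl; apply/tP => //; rewrite hk.
Qed.

(** A run is represented by its last, hence largest, level [H]; its maximality is recorded as a
    change of type at the head of [q]. *)
Lemma run_decomp b : b \in runs st s -> exists c H p q,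
  [/\ b = rcons c H, s = p ++ rcons c H ++ q, all (fun L => st L H) c &
      q = [::] \/ ~~ st H (head set0 q)].
Proof.
move=> br; have := runs_flatten st s; have := runs_separated set0 st s.
have := allP (runs_sorted st s) _ br; have := allP (runs_nonempty st s) _ br.
have ne := runs_nonempty st s.
case/splitPr: br ne => rs1 rs2 ne; case: (lastP b) ne => // c H ne _ sb sep fl.
rewrite flatten_cat /= in fl.
exists c, H, (flatten rs1), (flatten rs2); split => //.
- have sub : {subset rcons c H <= s}.
    by move=> x xb; rewrite -fl !mem_cat xb orbT.
  move: sb; rewrite (@sorted_pairwise_in _ [in s]).
  + by rewrite pairwise_rcons => /andP[].
  + exact: st_trans.
  + exact/allP.
- move: ne sep; rewrite all_cat => /and3P[_ _]; case: rs2 {fl} => [|b2 rs2] /=.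
    by left.
  move=> /andP[nb2 _] /cat_sorted2[_] /= /andP[]; rewrite last_rcons.
  by case: b2 nb2 => //= x b2 _ nst _; right.
Qed.

(** The union of a run is its top level [glevel k]. Elements of [K] in it lie in [level k] because
    no level of another type fits between; elements above it are cut off by the level that follows
    the run. *)
Lemma coalesce_run b : b \in runs st s ->
  exists2 k, k != 1 & [/\ last set0 b = glevel k,
    coalesce K b = val @^-1` glevel k & coalesce K b = level k].
Proof.
move=> /run_decomp[c [H [p [q [-> sE _ qE]]]]].
have Hs : H \in s by rewrite sE !mem_cat mem_rcons inE eqxx orbT.
have /mem_metP[k k1 HE] := Hs.
exists k => //.
move: lt_s; rewrite sE pairwise_cat => /and3P[/allrelP pbq _].
rewrite pairwise_cat => /and3P[/allrelP bq + qq].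
rewrite pairwise_rcons => /andP[/allP cH _].
have Hb : H \in rcons c H by rewrite mem_rcons inE eqxx.
have coalE k' : coalesce K (rcons c H) k' <-> H (val k').
  split=> [[L /=]|Hk']; last by exists H.
  rewrite mem_rcons inE => /orP[/eqP->//|/cH/asboolP[LH _]]; exact: LH.
split; first by rewrite last_rcons.
  by rewrite -HE; apply/seteqP; split=> k' /coalE.
apply/seteqP; split=> k'.
  move=> /coalE; rewrite HE => Hk'.
  have [->|k'1] := eqVneq k' 1; first exact: level1.
  apply/(induced_levelP cG) => // w w1 kw wk';
    apply/esym/(type_of_glevel cG) => //.
  by apply: subset_trans wk' _; apply/(glevel_sub cG).
have [->|k'1] := eqVneq k' 1; first by move=> _; apply/coalE; rewrite HE;
  exact: level1.
move=> kk'; apply/coalE; rewrite HE; apply/(glevel_sub cG) => //.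
apply: contrapT => nk'k.
have kk : glevel k `<=` glevel k' by case: (glevel_total cG k1 k'1).
have : glevel k' \in s by apply/mem_metP; exists k'.
rewrite sE !mem_cat => /or3P[k'p|k'b|k'q].
- have Hbq : H \in rcons c H ++ q by rewrite mem_cat Hb.
  by have /asboolP[_] := pbq _ _ k'p Hbq; rewrite HE.
- move: k'b; rewrite mem_rcons inE => /orP[/eqP k'H|/cH/asboolP[]].
    by apply: nk'k; rewrite k'H HE.
  by rewrite HE.
(* The head of [q] lies between [glevel k] and [glevel k'], so [induced_levelP] would give it the
   type of [H]. *)
- case: qE => [q0|nHq]; first by rewrite q0 in k'q.
  have Wq : head set0 q \in q by case: (q) k'q => //= W q' _; rewrite mem_head.
  have /mem_metP[w w1 WE] : head set0 q \in s by rewrite sE !mem_cat Wq !orbT.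
  apply: (negP nHq); rewrite WE HE; apply/asboolP.
  apply/(same_typeP cG); rewrite ?type_of_val//; apply/esym.
  apply: (iffLR (induced_levelP cG k1 k'1) kk') => //.
    by have /asboolP[] := bq _ _ Hb Wq; rewrite HE WE.
  rewrite -WE; case: (q) k'q qq => //= W q'.
  move=> /predU1P[-> _|k'q'] // /andP[/allP Wlt _].
  by have /asboolP[] := Wlt _ k'q'.
Qed.

Lemma coalesce_enumerates :
  enumerates [seq coalesce K b | b <- runs st s] (canonical_chain (induced K)).
Proof.
split.
  apply/seteqP; split=> [_ /= /mapP[b /coalesce_run[k k1 [_ _ ->]] ->]|].
    by exists k.
  move=> _ [k k1 <-] /=.
  have : glevel k \in flatten (runs st s).
    by rewrite runs_flatten; apply/mem_metP; exists k.
  move=> /flattenP[b br kb]; apply/mapP; exists b => //.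
  have [h h1 [bh _ ->]] := coalesce_run br.
  (* The levels of [k] and of the top [h] of its run agree once their blocks do, that is, once [h]
     and [k] are linked. *)
  rewrite -[LHS](block_level_link_class cG k1) -(block_level_link_class cG h1).
  congr (block_level K _); apply/esym.
  apply: (block_link_class cG k1); first exact: link_class_block.
  apply/(link_classP _ k1).
  have [c [H [p [q [bE sE stc _]]]]] := run_decomp br.
  rewrite {}bE last_rcons in bh kb; rewrite {}bh in kb stc sE.
  move: lt_s; rewrite sE pairwise_cat => /and3P[/allrelP pbq _].
  rewrite pairwise_cat => /and3P[/allrelP bq + _].
  rewrite pairwise_rcons => /andP[/allP ch _] w w1.
  have hb : glevel h \in rcons c (glevel h) by rewrite mem_rcons mem_head.
  have kh : glevel k `<=` glevel h.
    by move: kb; rewrite mem_rcons inE => /orP[/eqP->|/ch/asboolP[]].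
  case=> -[h1w wk]; first by apply: (type_of_glevel cG) => //;
    exact: subset_trans kh.
  have : glevel w \in s by apply/mem_metP; exists w.
  rewrite sE !mem_cat => /or3P[wp|wb|wq].
  - have kbq : glevel k \in rcons c (glevel h) ++ q by rewrite mem_cat kb.
    by have /asboolP[] := pbq _ _ wp kbq.
  - move: wb; rewrite mem_rcons inE => /orP[/eqP wh|/(allP stc)/asboolP].
      by apply: (type_of_glevel cG) => //; rewrite wh.
    by move=> /(same_typeP cG); rewrite !type_of_val => ->.
  - by have /asboolP[] := bq _ _ hb wq.
move=> i j /andP[ij]; rewrite size_map => js.
have i_s := ltn_trans ij js.
rewrite !(nth_map [::])//.
set rs := runs st s in js i_s *; set bi := nth [::] rs i;
  set bj := nth [::] rs j.
have ri : bi \in rs := mem_nth [::] i_s.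
have rj : bj \in rs := mem_nth [::] js.
have [k k1 [bik -> _]] := coalesce_run ri.
have [h h1 [bjh -> _]] := coalesce_run rj.
have last_in b : b \in rs -> last set0 b \in b.
  by move=> /run_decomp[c [H [_ [_ [-> _ _ _]]]]];
    rewrite last_rcons mem_rcons mem_head.
have [kh nhk] : glevel k `<` glevel h.
  move: lt_s; rewrite -(runs_flatten st s) -/rs.
  (* Cutting the runs at [j] leaves run [i] in the first part and run [j] at the start of the
     second. *)
  rewrite -(cat_take_drop j rs) flatten_cat.
  rewrite pairwise_cat => /and3P[/allrelP ltd _ _].
  rewrite -bik -bjh; apply/asboolP; apply: ltd.
    apply/flattenP; exists bi; last exact: last_in.
    by rewrite /bi -(nth_take _ ij) mem_nth// size_takel// ltnW.
  apply/flattenP; exists bj; last exact: last_in.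
  by rewrite (drop_nth [::] js) mem_head.
split=> [k'|/(_ h (@level_id _ _ _))]; first exact: kh.
by move=> /(glevel_sub cG _ k1).
Qed.

Lemma coalesce_has_type b t : b \in runs st s -> common_type [set` b] t ->
  has_type (coalesce K b) t.
Proof.
move=> br bt; have [k k1 [bk _ ->]] := coalesce_run br.
have [c [H [_ [_ [bE _ _ _]]]]] := run_decomp br.
have /(glevel_has_type cG _ k1)-> : has_type (glevel k) t.
  by apply: bt; rewrite /= -bk bE last_rcons mem_rcons mem_head.
exact: (level_has_type (cograph_induced K cG) k1).
Qed.

End Coalescing.

Theorem theorem1p4 (d : Order.disp_t) (G : orderedGroupType d)
    (K : groupClosed G) (hG : N_free G) :
  [/\ met_levels K `<=` canonical_chain G,
      canonical_chain (induced K) = [set block_level K B | B in blocks K],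
      forall B t, blocks K B -> common_type B t -> has_type (block_level K B) t
    & finite_set (met_levels K) ->
      exists s : seq (set G),
        enumerates s (canonical_chain G `\` ~` met_levels K) /\
        let rs := runs (fun H L => `[< same_type H L >]) s in
        enumerates [seq coalesce K b | b <- rs] (canonical_chain (induced K)) /\
        forall b t, b \in rs -> common_type [set` b] t ->
          has_type (coalesce K b) t].
Proof.
have cG := N_free_cograph hG.
have met_canonical : met_levels K `<=` canonical_chain G.
  by move=> _ [k [_ k1] <-]; exists k.
split => //.
- apply/seteqP; split=> [_ [k k1 <-]|_ [B /(blocksP K cG)[k k1 ->] <-]].
    by exists (link_class k);
      [exact: link_class_block|exact: block_level_link_class].
  by rewrite (block_level_link_class cG k1); exists k.
- move=> B t /(blocksP K cG)[k k1 ->] kt;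
    rewrite (block_level_link_class cG k1).
  have /(glevel_has_type cG _ k1)-> := kt _ (link_class_id cG k1).
  exact: (level_has_type (cograph_induced K cG) k1).
- move=> fin; have [s [met_s lt_s]] : exists s, enumerates s (met_levels K).
    apply: finite_chain_enumerates fin _ => L M.
    by move=> /met_levelsP[k k1 ->] /met_levelsP[h h1 ->]; exact: glevel_total.
  (* Deleting the unmet levels leaves the met ones, as these all belong to the canonical chain. *)
  exists s; split; first by rewrite setDE setCK setIidr.
  have /enumeratesP[_ lt_s'] : enumerates s (met_levels K) by [].
  split; first exact: coalesce_enumerates.
  by move=> b t; exact: coalesce_has_type.
Qed.
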